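(* Let $M=(\ell_\infty\setminus c_0)\cup\{0\}$, regarded as a subset of $\ell_\infty$, and let $\mathfrak{c}=2^{\aleph_0}$. Then: (1) $M$ is $(d,n)$-algebrable and $(d,m)$-$C^*$-algebrable for all $d,m,n\in\mathbb{N}$ with $d\ge m$ and $d\ge n$. (2) $M$ is $(\mathfrak{c},\kappa)$-$C^*$-algebrable for all cardinals $1\le\kappa\le\mathfrak{c}$. (3) $M$ is $(\aleph_0,\kappa)$-algebrable for all cardinals $1\le\kappa\le\aleph_0$. (4) $M$ is $(\kappa,\kappa)$-algebrable for all cardinals $\aleph_0<\kappa\le\mathfrak{c}$.
   Context: $\ell_\infty$ is the $C^*$-algebra of bounded complex sequences, $c_0$ its ideal of null sequences, $\mathbb{N}=\{1,2,\dots\}$; $\dim$ is the algebraic (Hamel) dimension over $\mathbb{C}$. For a nonempty subset $S$ of an algebra, $A(S)$ denotes the linear span of all finite products $s_1\cdots s_n$ ($n\ge1$, $s_i\in S$). $S$ generates an algebra $B$ as an algebra if $S\subseteq B$ and $A(S)=B$. A nonempty set $S\subseteq B_{sa}=\{b\in B:b=b^*\}$ generates a $C^*$-algebra $B$ as a $C^*$-algebra if $\overline{A(S)}=B$. Convention: for $C^*$-algebras and for self-adjoint ($*$-closed) subalgebras of $C^*$-algebras only generating sets consisting of self-adjoint elements are considered. A generating set is minimal if no proper subset of it generates (in the same sense). Let $\alpha,\beta$ be cardinals. A subset $M$ of a Banach algebra $A$ is $(\alpha,\beta)$-algebrable if there is a subalgebra $B$ of $A$ (not necessarily closed) with $B\subseteq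 M\cup\{0\}$, $\dim(B)=\alpha$, and a minimal generating set $S$ of $B$ as an algebra with $|S|=\beta$. A subset $M$ of a $C^*$-algebra $A$ is $(\alpha,\beta)$-$C^*$-algebrable if there is a $C^*$-subalgebra $B$ of $A$ with $B\subseteq M\cup\{0\}$, $\dim(B)=\alpha$, and a minimal generating set $S$ of $B$ as a $C^*$-algebra with $|S|=\beta$. *)

(* Defs.v *)
From HB Require Import structures.
From mathcomp Require Import all_boot all_order all_algebra.
From mathcomp Require Import all_classical all_reals all_analysis.
From mathcomp Require Import complex.
Set Implicit Arguments.
Unset Strict Implicit.
Unset Printing Implicit Defensive.
Import Order.TTheory GRing.Theory Num.Theory.
Import numFieldNormedType.Exports.
Local Open Scope classical_set_scope.
Local Open Scope ring_scope.

Local Open Scope complex_scope.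
Local Open Scope card_scope.

(* Cardinals are represented by sets, in arbitrary types, of that cardinality:
   [`I_n] for n, [[set: nat]] for aleph_0, [[set: set nat]] for 2 ^ aleph_0. *)
Definition card_lt T U (A : set T) (B : set U) : Prop :=
  A #<= B /\ ~ (B #<= A).

Section linear_span.
Variables (K : pzRingType) (V : lmodType K).
Implicit Types B H S : set V.

Definition linear_span S : set V :=
  [set x | exists n (c : 'I_n -> K) (v : 'I_n -> V),
     (forall i, S (v i)) /\ x = \sum_(i < n) c i *: v i].

Definition linearly_independent H : Prop :=
  forall n (c : 'I_n -> K) (v : 'I_n -> V),
    injective v -> (forall i, H (v i)) -> \sum_(i < n) c i *: v i = 0 ->
    forall i, c i = 0.

Definition hamel_basis B H : Prop :=
  linearly_independent H /\ linear_span H = B.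

Definition has_dim T B (a : set T) : Prop :=
  exists H, hamel_basis B H /\ H #= a.

End linear_span.

Section algebra_span.
Variables (K : pzRingType) (A : lalgType K).
Implicit Types B S : set A.

Definition products S : set A :=
  [set x | exists n (s : 'I_n.+1 -> A),
     (forall i, S (s i)) /\ x = \prod_(i < n.+1) s i].

Definition alg_span S : set A := linear_span (products S).

(* A subalgebra need not contain the unit of [A]. *)
Definition subalgebra B : Prop :=
  [/\ B 0, forall x y, B x -> B y -> B (x + y),
      forall (c : K) x, B x -> B (c *: x)
    & forall x y, B x -> B y -> B (x * y)].

End algebra_span.

Section complex_topology.
Variable R : realType.

(* The library equips [R[i]^o], but not [R[i]], with its usual topology. *)
HB.instance Definition _ := GRing.ComAlgebra.copy R[i] R[i]^o.
HB.instance Definition _ := NormedModule.copy R[i] R[i]^o.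

End complex_topology.

Section linfty.
Variable R : realType.
Local Notation C := R[i].

Definition bounded_seq : {pred nat -> C} := fun f => `[< bounded_fun f >].

Lemma bounded_seqP (f : nat -> C) :
  reflect (exists M : C, forall n, `|f n| <= M) (f \in bounded_seq).
Proof.
apply: (iffP (asboolP _)) => [[M [Mreal fM]]|[M fM]].
  by exists (M + 1) => n; apply: fM => //; rewrite ltrDl.
exists M; split; first by rewrite ger0_real// (le_trans _ (fM 0%N)).
by move=> x Mx n _; exact: le_trans (fM n) (ltW Mx).
Qed.

Fact bounded_seq_subring : GRing.subring_closed bounded_seq.
Proof.
split.
- by apply/bounded_seqP; exists 1 => n; rewrite normr1.
- move=> f g /bounded_seqP[M fM] /bounded_seqP[N gN].
  apply/bounded_seqP; exists (M + N) => n.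
  by rewrite (le_trans (ler_normB _ _))// lerD.
- move=> f g /bounded_seqP[M fM] /bounded_seqP[N gN].
  apply/bounded_seqP; exists (M * N) => n.
  by rewrite normrM ler_pM.
Qed.

Fact bounded_seq_subsemimod : GRing.subsemimod_closed bounded_seq.
Proof.
split; first split.
- by apply/bounded_seqP; exists 0 => n; rewrite normr0.
- move=> f g /bounded_seqP[M fM] /bounded_seqP[N gN].
  apply/bounded_seqP; exists (M + N) => n.
  by rewrite (le_trans (ler_normD _ _))// lerD.
- move=> c f /bounded_seqP[M fM]; apply/bounded_seqP; exists (`|c| * M) => n.
  by rewrite normrM ler_wpM2l.
Qed.

Record linfty := Linfty {
  linfty_val :> nat -> C ;
  linftyP : linfty_val \in bounded_seq }.

HB.instance Definition _ := [isSub for linfty_val].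
HB.instance Definition _ := [Choice of linfty by <:].
HB.instance Definition _ := GRing.SubChoice_isSubComNzRing.Build
  (nat -> C) bounded_seq linfty bounded_seq_subring.
HB.instance Definition _ := GRing.SubZmodule_isSubLmodule.Build
  C (nat -> C) bounded_seq linfty bounded_seq_subsemimod.

Fact linfty_scalerAl (c : C) (f g : linfty) : c *: (f * g) = (c *: f) * g.
Proof. by apply/val_inj/funext => n; rewrite /= [LHS]mulrA. Qed.

HB.instance Definition _ :=
  GRing.Lmodule_isLalgebra.Build C linfty linfty_scalerAl.
HB.instance Definition _ := GRing.Lalgebra_isComAlgebra.Build C linfty.

(* Norms take their values in the scalar field [R[i]], so the real number
   [sup_n |f n|] is embedded in it. *)
Definition linfty_norm (f : linfty) : C :=
  (sup (range (fun n => complex.Re `|f n|)))%:C.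

Lemma le_linfty_norm (f : linfty) n : `|f n| <= linfty_norm f.
Proof.
have /bounded_seqP[M fM] := linftyP f.
have Mr : M \is Num.real by rewrite ger0_real// (le_trans _ (fM 0%N)).
rewrite -[X in X <= _]RRe_real// lecR; apply: ub_le_sup; last by exists n.
exists (complex.Re M) => _ [k _ <-].
by rewrite -lecR !RRe_real.
Qed.

Lemma linfty_norm_le (f : linfty) (M : C) :
  (forall n, `|f n| <= M) -> linfty_norm f <= M.
Proof.
move=> fM.
have Mr : M \is Num.real by rewrite ger0_real// (le_trans _ (fM 0%N)).
rewrite -[X in _ <= X]RRe_real// lecR; apply: ge_sup.
  by exists (complex.Re `|f 0%N|), 0%N.
by move=> _ [k _ <-]; rewrite -lecR !RRe_real.
Qed.

Fact linfty_normD (f g : linfty) :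
  linfty_norm (f + g) <= linfty_norm f + linfty_norm g.
Proof.
apply: linfty_norm_le => n; apply: le_trans (ler_normD _ _) _.
by rewrite lerD// le_linfty_norm.
Qed.

Fact linfty_normZ (c : C) (f : linfty) :
  linfty_norm (c *: f) = `|c| * linfty_norm f.
Proof.
have norm_le (d : C) (g : linfty) :
    linfty_norm (d *: g) <= `|d| * linfty_norm g.
  apply: linfty_norm_le => n.
  by rewrite [`|_|]normrM ler_wpM2l// le_linfty_norm.
apply/eqP; rewrite eq_le norm_le/=; have [->|c0] := eqVneq c 0.
  by rewrite normr0 mul0r (le_trans _ (le_linfty_norm _ 0%N)).
rewrite -ler_pdivlMl ?normr_gt0// -normfV.
by rewrite -{1}[f]scale1r -(mulVf c0) -scalerA.
Qed.

Fact linfty_norm0_eq0 (f : linfty) : linfty_norm f = 0 -> f = 0.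
Proof.
move=> f0; apply/val_inj/funext => n; apply/eqP; rewrite -normr_le0 -f0.
exact: le_linfty_norm.
Qed.

HB.instance Definition _ := Lmodule_isNormed.Build C linfty
  linfty_normD linfty_normZ linfty_norm0_eq0.

Fact linfty_star_subproof (f : linfty) : (fun n => (f n)^*) \in bounded_seq.
Proof.
have /bounded_seqP[M fM] := linftyP f.
by apply/bounded_seqP; exists M => n; rewrite norm_conjC.
Qed.

Definition linfty_star (f : linfty) : linfty := Linfty (linfty_star_subproof f).

Definition c0 : set linfty := [set f | f @ \oo --> (0 : C)].

Definition star_closed (B : set linfty) : Prop :=
  forall b, B b -> B (linfty_star b).

Definition selfadjoint_part (B : set linfty) : set linfty :=
  [set b | B b /\ b = linfty_star b].

Definition cstar_subalgebra (B : set linfty) : Prop :=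
  [/\ subalgebra B, star_closed B & closed B].

(* For a self-adjoint subalgebra [B], only generating sets that consist of
   self-adjoint elements are considered. *)
Definition generates_alg (B S : set linfty) : Prop :=
  [/\ S !=set0, S `<=` B, star_closed B -> S `<=` selfadjoint_part B
    & alg_span S = B].

Definition generates_cstar (B S : set linfty) : Prop :=
  [/\ S !=set0, S `<=` selfadjoint_part B & closure (alg_span S) = B].

Definition minimal_for (gen : set linfty -> Prop) (S : set linfty) : Prop :=
  gen S /\ forall S', S' `<` S -> ~ gen S'.

Definition algebrable T U (M : set linfty) (a : set T) (b : set U) : Prop :=
  exists B : set linfty,
    [/\ subalgebra B, B `<=` M `|` [set 0], has_dim B a
      & exists S, minimal_for (generates_alg B) S /\ S #= b].

Definition cstar_algebrable T U (M : set linfty) (a : set T) (b : set U) :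
    Prop :=
  exists B : set linfty,
    [/\ cstar_subalgebra B, B `<=` M `|` [set 0], has_dim B a
      & exists S, minimal_for (generates_cstar B) S /\ S #= b].

End linfty.

Arguments c0 R : clear implicits.

(* Main.v *)
Require Import Defs.
From mathcomp Require Import all_boot all_order all_algebra.
From mathcomp Require Import all_classical all_reals all_analysis.
From mathcomp Require Import complex.
From mathcomp Require Import zify.
Set Implicit Arguments.
Unset Strict Implicit.
Unset Printing Implicit Defensive.
Import Order.TTheory GRing.Theory Num.Theory.
Import numFieldNormedType.Exports.
Local Open Scope classical_set_scope.
Local Open Scope ring_scope.
Local Open Scope complex_scope.
Local Open Scope card_scope.

(** All the algebras are made of sequences that are constant on the fibres of
    one map [logn 2 : nat -> nat].  Every fibre is infinite, so such a sequence
    tends to 0 only if it vanishes: the condition on [c0] is automatic, and what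
    is left is to find algebras of bounded functions of [j = logn 2 n] with
    prescribed dimension and number of generators.  The value of a sequence
    at [j] is read off at the index [2 ^ j].

    Minimality is obtained by giving each generator [g t] a path [s t] of
    natural numbers along which every other generator tends to 0 and [g t] does
    not.  The sequences that are null along a path form a norm-closed
    subalgebra, so [g t] is not even in the closed algebra generated by the
    others.  This handles algebraic and C*-algebraic generation at once
    ([separated], [algebrable_separated], [cstar_algebrable_separated]), and it
    shows that the generators are linearly independent.

    There are continuum many such generators: to a set [X] of natural numbers
    corresponds a branch of the binary tree, whose nodes are coded by natural
    numbers, and two distinct branches share only finitely many nodes.  The
    indicators of the branches are separated by the branches
    themselves.  The code 0 is not a node, which leaves room for one further
    generator, [geo = 2 ^- j], separated by the constant path 0.

    The infinite dimensions are computed by extracting a Hamel basis between an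
    independent set and a spanning set of the same cardinality
    ([has_dim_between]).

    - [d] finite: functions supported by [j < d], generated by [n - 1] atoms and
      by the restriction of [geo] to the remaining points, whose values are
      distinct and nonzero, so that Lagrange interpolation yields the remaining
      atoms.
    - Continuum: the closed algebra generated by [geo] and branch indicators.
      Powers of rescaled tails of [geo] converge to the atoms, so the algebra
      contains all the products of [geo] with indicators of branches, which are
      independent; and the whole space has only continuum many elements.
    - Countable: the algebra generated by [geo] and branch indicators.  It
      contains the powers of [geo], and countably many products span it.
    - Uncountable [k]: the algebra generated by [k] branch indicators alone.
      A product of two of them is the indicator of a finite set, hence the
      algebra is spanned by [k] independent vectors and countably many
      others. *)

(** * Linear spans and Hamel bases *)

Definition subspace (K : pzRingType) (V : lmodType K) (W : set V) : Prop :=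
  [/\ W 0, forall x y, W x -> W y -> W (x + y)
    & forall (c : K) x, W x -> W (c *: x)].

Section LinearSpan.
Variables (K : pzRingType) (V : lmodType K).
Implicit Types (S W : set V) (x : V).

Lemma subspace_sum W : subspace W ->
  forall n (c : 'I_n -> K) (v : 'I_n -> V) (P : pred 'I_n),
    (forall i, P i -> W (v i)) -> W (\sum_(i < n | P i) c i *: v i).
Proof.
move=> [W0 WD WZ] n c v P Wv; elim/big_ind: _ => // i Pi.
exact/WZ/Wv.
Qed.

Lemma linear_span_min S W : subspace W -> S `<=` W -> linear_span S `<=` W.
Proof.
by move=> sW SW _ [n [c [v [Sv ->]]]]; apply: subspace_sum => // i _; exact: SW.
Qed.

Lemma sub_linear_span S : S `<=` linear_span S.
Proof.
move=> x Sx; exists 1%N, (fun=> 1), (fun=> x); split => //.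
by rewrite big_ord1 scale1r.
Qed.

Lemma linear_span_subspace S : subspace (linear_span S).
Proof.
split.
- by exists 0%N, (fun=> 0), (fun=> 0); split => [[]//|]; rewrite big_ord0.
- move=> _ _ [n [c [v [Sv ->]]]] [m [d [w [Sw ->]]]].
  exists (n + m)%N,
    (fun k => match fintype.split k with inl i => c i | inr j => d j end),
    (fun k => match fintype.split k with inl i => v i | inr j => w j end).
  split=> [k|]; first by case: fintype.splitP.
  rewrite big_split_ord; congr (_ + _); apply: eq_bigr => i _.
    by rewrite -[lshift m i]/(unsplit (inl i)) unsplitK.
  by rewrite -[rshift n i]/(unsplit (inr i)) unsplitK.
- move=> a _ [n [c [v [Sv ->]]]]; exists n, (fun i => a * c i), v; split=> //.
  by rewrite scaler_sumr; apply: eq_bigr => i _; rewrite scalerA.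
Qed.

Lemma linear_span_le S W :
  S `<=` linear_span W -> linear_span S `<=` linear_span W.
Proof. exact: linear_span_min (linear_span_subspace W). Qed.

End LinearSpan.

Section HamelBasis.
Variables (K : fieldType) (V : lmodType K).
Implicit Types (I G H : set V).

(** If a relation involves the new vector with a nonzero coefficient, dividing
    by it writes the new vector in terms of the old ones. *)
Lemma linearly_independentU1 I g :
  linearly_independent I -> ~ linear_span I g ->
  linearly_independent (I `|` [set g]).
Proof.
move=> indI gI n c v vinj Iv vc.
have [[i0 vi0]|ng] := pselect (exists i0, v i0 = g); last first.
  apply: (indI n c v) => // i; have [//|/= vig] := Iv i.
  by case: ng; exists i.
have IvN i : i != i0 -> I (v i).
  by have [//|/= vig] := Iv i; rewrite -(inj_eq vinj) vig vi0 eqxx.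
have ci0 : c i0 = 0.
  apply/eqP/negP => /negP ci0; apply: gI.
  rewrite -vi0 -[v i0]scale1r -(mulVf ci0) -scalerA.
  have [_ _ spZ] := linear_span_subspace I; apply: (spZ).
  have -> : c i0 *: v i0 = - \sum_(i < n | i != i0) c i *: v i.
    by move/eqP: vc; rewrite (bigD1 i0)//= addr_eq0 => /eqP.
  rewrite -scaleN1r; apply: spZ; apply: subspace_sum.
    exact: linear_span_subspace.
  by move=> i /IvN; exact: sub_linear_span.
case: n => [|n] in c v vinj Iv vc i0 vi0 IvN ci0 *.
  by case: i0 {vi0 IvN ci0}.
have c' := indI n (fun j => c (lift i0 j)) (fun j => v (lift i0 j)).
move=> i; have [j ->|->//] := unliftP i0 i; apply: c'.
- by move=> j1 j2 /vinj /lift_inj.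
- by move=> k; apply: IvN; rewrite eq_sym neq_lift.
- by move: vc; rewrite (bigD1_ord i0)//= ci0 scale0r add0r.
Qed.

(** Zorn's lemma applied to the sets of generators that remain independent
    together with [I]; a relation involves finitely many vectors, so it already
    occurs in a member of a chain. *)
Lemma hamel_basis_between I G : linearly_independent I -> I `<=` G ->
  exists H, [/\ I `<=` H, H `<=` G & hamel_basis (linear_span G) H].
Proof.
move=> indI IG.
pose P : set (set V) := [set H | H `<=` G /\ linearly_independent (I `|` H)].
have [|H [[HG indH] Hmax]] := @Zorn_bigcup _ P.
  move=> F FP totF; split => [x [X /FP[XG _]]|]; first exact: XG.
  move=> n c v vinj Fv.
  (* [set0] is allowed for the case where all the vectors are in [I], since the
     chain may be empty. *)
  have [X [FX Xv]] : exists X, (F X \/ X = set0) /\ forall i, (I `|` X) (v i).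
    suff: forall m, exists X, (F X \/ X = set0) /\
        forall i : 'I_n, (i < m)%N -> (I `|` X) (v i).
      by move=> /(_ n)[X [FX Xv]]; exists X; split => // i; exact: Xv.
    elim=> [|m [X [FX Xv]]]; first by exists set0; split; [right|].
    have [mn|nm] := ltnP m n; last first.
      exists X; split => // i im; apply: Xv.
      by rewrite (leq_trans (ltn_ord i)).
    have [Im|[Y FY Ym]] := Fv (Ordinal mn).
      exists X; split=> // i; rewrite ltnS leq_eqVlt => /predU1P[im|/Xv//].
      by left; rewrite (_ : i = Ordinal mn)//; exact: val_inj.
    have YE (i : 'I_n) : i = m :> nat -> Y (v i).
      by move=> im; rewrite (_ : i = Ordinal mn)//; exact: val_inj.
    have [XY|YX] : X `<=` Y \/ Y `<=` X.
      by case: FX => [FX|->]; [exact: totF|left].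
    - exists Y; split=> [|i]; first by left.
      rewrite ltnS leq_eqVlt => /predU1P[/YE|/Xv[Ii|/XY Yi]]; first by right.
        by left.
      by right.
    - exists X; split=> // i.
      by rewrite ltnS leq_eqVlt => /predU1P[/YE/YX Xi|/Xv//]; right.
  case: FX => [/FP[_ indX]|X0]; first exact: indX.
  apply: indI => // i; by have := Xv i; rewrite X0 setU0.
exists (I `|` H); split; first by left.
  by move=> x [/IG//|/HG].
split=> //; apply/seteqP; split.
  by apply: linear_span_le => x [/IG|/HG] Gx; exact: sub_linear_span.
apply: linear_span_le => g Gg; apply: contrapT => gN.
apply: (Hmax (H `|` [set g])).
  split=> [|/(_ g (or_intror erefl)) Hg]; first by left.
  by apply: gN; apply: sub_linear_span; right.
split=> [x [/HG//|->//]|]; rewrite setUA.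
exact: linearly_independentU1.
Qed.

(** A relation between separated vectors would put a scalar multiple of one of
    them into the subspace that contains all the others but not this one. *)
Lemma separated_linearly_independent T (k : set T) (g : T -> V)
    (W : T -> set V) :
  (forall t, k t -> subspace (W t)) ->
  (forall t u, k t -> k u -> t <> u -> W t (g u)) ->
  (forall t, k t -> ~ W t (g t)) ->
  linearly_independent (g @` k).
Proof.
move=> sW Wg Wgt n c v vinj gv vc i.
have [t kt gt] := gv i; have [W0 WD WZ] := sW t kt.
have Wv j : j != i -> W t (v j).
  move=> ji; have [u ku gu] := gv j; rewrite -gu; apply: Wg => // tu.
  by move: ji; rewrite -(inj_eq vinj) -gu -gt tu eqxx.
apply/eqP/negP => /negP ci; apply: (Wgt t kt); rewrite gt.
rewrite -[v i]scale1r -(mulVf ci) -scalerA; apply: (WZ).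
have -> : c i *: v i = - \sum_(j < n | j != i) c j *: v j.
  by move/eqP: vc; rewrite (bigD1 i)//= addr_eq0 => /eqP.
by rewrite -scaleN1r; apply: WZ; apply: subspace_sum (sW t kt) _ _ _ _ _.
Qed.

(** By Cantor-Bernstein, it is enough to bound the basis from both sides; no
    invariance of the dimension is involved. *)
Lemma has_dim_between T (a : set T) I G :
  linearly_independent I -> I `<=` G -> a #<= I ->
  (forall H, H `<=` G -> H #<= a) -> has_dim (linear_span G) a.
Proof.
move=> indI IG aI Ga; have [H [IH HG bH]] := hamel_basis_between indI IG.
exists H; split => //; apply: Cantor_Bernstein; first exact: Ga.
exact: card_le_trans aI (subset_card_le IH).
Qed.

End HamelBasis.

(** * Generated subalgebras *)

Section AlgebraSpan.
Variables (K : comPzRingType) (A : algType K).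
Implicit Types (S W : set A).

Lemma subalgebra_subspace W : subalgebra W -> subspace W.
Proof. by case. Qed.

Lemma alg_span_min S W : subalgebra W -> S `<=` W -> alg_span S `<=` W.
Proof.
move=> sW SW; apply: linear_span_min; first exact: subalgebra_subspace.
move=> _ [n [s [Ss ->]]]; elim: n s Ss => [|n IH] s Ss.
  by rewrite big_ord1; exact: SW.
have [_ _ _ WM] := sW; rewrite big_ord_recl; apply: WM; first exact: SW.
exact: IH.
Qed.

Lemma sub_products S : S `<=` products S.
Proof. by move=> x Sx; exists 0%N, (fun=> x); rewrite big_ord1. Qed.

Lemma sub_alg_span S : S `<=` alg_span S.
Proof. by move=> x /sub_products; exact: sub_linear_span. Qed.

Lemma productsM S x y : products S x -> products S y -> products S (x * y).
Proof.
move=> [n [s [Ss ->]]] [m [t [St ->]]].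
exists (n + m.+1)%N,
  (fun k : 'I_(n.+1 + m.+1) =>
     match fintype.split k with inl i => s i | inr j => t j end).
split=> [k|]; first by case: fintype.splitP.
rewrite (@big_split_ord _ _ _ n.+1 m.+1); congr (_ * _); apply: eq_bigr => i _.
  by rewrite -[lshift _ i]/(unsplit (inl i)) unsplitK.
by rewrite -[rshift _ i]/(unsplit (inr i)) unsplitK.
Qed.

Lemma alg_span_subalgebra S : subalgebra (alg_span S).
Proof.
have [sp0 spD spZ] := linear_span_subspace (products S).
split=> // x y; move: x; apply: linear_span_min.
  split=> [yS|x1 x2 + + yS|c x + yS].
  - by rewrite mul0r.
  - by move=> /(_ yS) h1 /(_ yS) h2; rewrite mulrDl; exact: spD.
  - by move=> /(_ yS) h; rewrite -scalerAl; exact: spZ.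
move=> x Sx; move: y; apply: linear_span_min; first split.
- by rewrite mulr0.
- by move=> y1 y2 h1 h2; rewrite mulrDr; exact: spD.
- by move=> c y h; rewrite -scalerAr; exact: spZ.
- by move=> y Sy; apply: sub_linear_span; exact: productsM.
Qed.

Lemma subalgebraX W x n : subalgebra W -> W x -> W (x ^+ n.+1).
Proof.
by move=> [_ _ _ WM] Wx; elim: n => // n IH; rewrite exprS; exact: WM.
Qed.

Lemma subalgebraB W x y : subalgebra W -> W x -> W y -> W (x - y).
Proof.
by move=> [_ WD WZ _] Wx Wy; rewrite -scaleN1r; apply: WD => //; exact: WZ.
Qed.

End AlgebraSpan.

(** * Norm closures in [linfty] *)

Section ClosedSubalgebras.
Variable R : realType.
Local Notation C := R[i].
Implicit Types (B S W : set (linfty R)) (f g : linfty R).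

Lemma closure_linftyP B f :
  closure B f <-> forall e : C, 0 < e -> exists2 g, B g & `|f - g| < e.
Proof.
split=> [fB e e0|fB U /nbhs_ballP[e e0 eU]].
  have [|g [Bg fg]] := fB (ball f e); first exact: nbhsx_ballx.
  by exists g => //; move: fg; rewrite -ball_normE.
have [g Bg fg] := fB e e0; exists g; split => //.
by apply: eU; rewrite -ball_normE.
Qed.

Lemma linfty_norm_lt f (e : C) : `|f| < e -> forall n, `|f n| < e.
Proof. by move=> fe n; apply: le_lt_trans fe; exact: le_linfty_norm. Qed.

Lemma linftyD f g n : (f + g) n = f n + g n. Proof. by []. Qed.
Lemma linftyB f g n : (f - g) n = f n - g n. Proof. by []. Qed.
Lemma linftyM f g n : (f * g) n = f n * g n. Proof. by []. Qed.
Lemma linftyZ (c : C) f n : (c *: f) n = c * f n. Proof. by []. Qed.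
Lemma linfty1 n : (1 : linfty R) n = 1. Proof. by []. Qed.
Lemma linftyX f m n : (f ^+ m) n = f n ^+ m.
Proof. by elim: m => // m IH; rewrite !exprS linftyM IH. Qed.
Lemma linfty_sum I (r : seq I) (P : pred I) (F : I -> linfty R) n :
  (\sum_(i <- r | P i) F i) n = \sum_(i <- r | P i) F i n.
Proof. by elim/big_rec2: _ => // i x y _ <-. Qed.

Lemma linfty_ext f g : f =1 g -> f = g.
Proof. by move=> fg; apply/val_inj/funext. Qed.

Lemma linfty_normM f g : `|f * g| <= `|f| * `|g|.
Proof.
apply: linfty_norm_le => n; rewrite linftyM normrM.
by apply: ler_pM => //; exact: le_linfty_norm.
Qed.

Lemma linfty_norm_star f : `|linfty_star f| = `|f|.
Proof.
by apply/eqP; rewrite eq_le; apply/andP; split; apply: linfty_norm_le => n;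
  have := le_linfty_norm f n;
  have := le_linfty_norm (linfty_star f) n; rewrite /= norm_conjC.
Qed.

(** All the algebra operations are Lipschitz in each argument, the others being
    fixed, so their continuity on closures is a single statement. *)
Lemma closure_lipschitz (phi : linfty R -> linfty R) (k : C) B W :
  0 <= k -> (forall f g, `|phi f - phi g| <= k * `|f - g|) ->
  (forall f, B f -> closure W (phi f)) ->
  forall f, closure B f -> closure W (phi f).
Proof.
move=> k0 phik BW f /closure_linftyP fB; apply/closure_linftyP => e e0.
have k1 : 0 < k + 1 by rewrite ltr_wpDl.
have [|g Bg fg] := fB (e / 2 / (k + 1)); first by rewrite !divr_gt0.
have e20 : 0 < e / 2 by rewrite divr_gt0.
have /closure_linftyP/(_ _ e20)[h Wh gh] := BW g Bg.
exists h => //; rewrite -(subrKA (phi g)) (le_lt_trans (ler_normD _ _))//.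
rewrite [ltRHS]splitr ler_ltD// (le_trans (phik _ _))//.
rewrite ltr_pdivlMr// in fg; rewrite (le_trans _ (ltW fg))// mulrC.
by rewrite ler_wpM2l// lerDl.
Qed.

(** For a binary operation, first one argument then the other is moved to the
    closure. *)
Lemma closure_subalgebra B : subalgebra B -> subalgebra (closure B).
Proof.
move=> [B0 BD BZ BM]; have sB := @subset_closure _ B.
split=> [|f g fB gB|c f fB|f g fB gB]; first exact: sB.
- have BDl h h' : closure B h -> B h' -> closure B (h + h').
    move=> + Bh'; apply: (@closure_lipschitz (+%R^~ h') 1) => //.
      by move=> a b; rewrite mul1r opprD addrACA subrr addr0.
    by move=> a Ba; apply: sB; exact: BD.
  move: g gB; apply: (@closure_lipschitz (+%R f) 1) => //.
    by move=> a b; rewrite mul1r opprD addrACA subrr add0r.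
  by move=> g Bg; exact: BDl.
- move: f fB; apply: (@closure_lipschitz ( *:%R c) `|c|) => //.
    by move=> a b; rewrite -scalerBr normrZ.
  by move=> a Ba; apply: sB; exact: BZ.
- have BMl h h' : closure B h -> B h' -> closure B (h * h').
    move=> + Bh'; apply: (@closure_lipschitz ( *%R^~ h') `|h'|) => //.
      by move=> a b; rewrite -mulrBl mulrC linfty_normM.
    by move=> a Ba; apply: sB; exact: BM.
  move: g gB; apply: (@closure_lipschitz ( *%R f) `|f|) => //.
    by move=> a b; rewrite -mulrBr linfty_normM.
  by move=> g Bg; exact: BMl.
Qed.

Lemma linfty_starM f g :
  linfty_star (f * g) = linfty_star f * linfty_star g.
Proof. by apply: linfty_ext => n; rewrite /= [LHS]rmorphM. Qed.

Lemma linfty_starB f g : linfty_star (f - g) = linfty_star f - linfty_star g.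
Proof. by apply: linfty_ext => n; rewrite /= [LHS]rmorphB. Qed.

Lemma closure_star_closed B : star_closed B -> star_closed (closure B).
Proof.
move=> Bstar f; apply: (@closure_lipschitz (@linfty_star R) 1) => //.
  by move=> a b; rewrite mul1r -linfty_starB linfty_norm_star.
by move=> a Ba; apply: subset_closure; exact: Bstar.
Qed.

Lemma alg_span_star_closed S : (forall f, S f -> linfty_star f = f) ->
  star_closed (alg_span S).
Proof.
move=> Sstar; have [A0 AD AZ AM] := alg_span_subalgebra S.
suff: alg_span S `<=` [set f | alg_span S f /\ alg_span S (linfty_star f)].
  by move=> Sf f /Sf[].
apply: alg_span_min; last first.
  by move=> f Sf /=; rewrite Sstar//; split; exact: sub_alg_span.
split=> /=.
- split=> //; rewrite (_ : linfty_star 0 = 0)//.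
  by apply: linfty_ext => n; exact: conjC0.
- move=> f g [Af Af'] [Ag Ag']; split; first exact: AD.
  rewrite (_ : linfty_star _ = linfty_star f + linfty_star g); first exact: AD.
  by apply: linfty_ext => n; rewrite /= [LHS]rmorphD.
- move=> c f [Af Af']; split; first exact: AZ.
  rewrite (_ : linfty_star _ = c^* *: linfty_star f); first exact: AZ.
  by apply: linfty_ext => n; rewrite /= [LHS]rmorphM.
- move=> f g [Af Af'] [Ag Ag']; split; first exact: AM.
  by rewrite linfty_starM; exact: AM.
Qed.

End ClosedSubalgebras.

(** * Branches of the binary tree *)

Section Branches.

(** The node reached after [n] steps along the characteristic function of [X],
    coded by the number whose binary digits are 1 followed by these steps. *)
Fixpoint branch (X : set nat) n : nat :=
  if n is m.+1 then ((branch X m).*2 + `[< X m >])%N else 1%N.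

Lemma branch_gt X n : (n < branch X n)%N.
Proof.
elim: n => //= n IH; rewrite (leq_trans _ (leq_addr _ _))//.
by rewrite -addnn -addn1 leq_add// (leq_trans _ IH).
Qed.

(** A node determines the steps that lead to it: they are recovered by parity
    and halving, down to the root 1. *)
Lemma branch_inj X Y n m : branch X n = branch Y m ->
  n = m /\ forall i, (i < n)%N -> (X i <-> Y i).
Proof.
elim: n m => [|n IH] [|m] //=.
- by move=> e; have := branch_gt Y m; lia.
- by move=> e; have := branch_gt X n; lia.
move=> e; have eb : `[< X n >] = `[< Y m >].
  by have := congr1 odd e; rewrite !oddD !odd_double !oddb.
move: e; rewrite eb => /addIn/double_inj/IH[nm XY].
rewrite -nm in eb *; split=> //.
move=> i; rewrite ltnS leq_eqVlt => /predU1P[->|/XY//].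
by split=> /asboolP; [rewrite eb|rewrite -eb] => /asboolP.
Qed.

(** Beyond the first place where [X] and [Y] differ, no node is common. *)
Lemma branch_disjoint X Y : X <> Y ->
  exists N, forall n, (N <= n)%N -> ~ range (branch Y) (branch X n).
Proof.
move=> XY; have [i Xi] : exists i, ~ (X i <-> Y i).
  apply: contrapT => /forallNP h; apply: XY; apply/seteqP.
  by split=> i; have /contrapT[] := h i.
exists i.+1 => n ni [m _ /esym/branch_inj[_]] /(_ i ni).
exact: Xi.
Qed.

End Branches.

(** * Sequences that are constant on infinite fibres *)

Section Algebrability.
Variable R : realType.
Local Notation C := R[i].
Implicit Types (B S W : set (linfty R)) (f g : linfty R).

Local Notation fiber := (logn 2).

Lemma fiber_pow j : fiber (2 ^ j) = j. Proof. exact: pfactorK. Qed.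

Lemma fiber_infinite j N : exists2 n, (N <= n)%N & fiber n = j.
Proof.
exists (2 ^ j * N.*2.+1)%N.
  rewrite (leq_trans _ (leq_pmull _ _)) ?expn_gt0// -addnn.
  by rewrite (leq_trans (leq_addr N N)).
by rewrite lognM ?expn_gt0// fiber_pow lognE/= dvdn2/= odd_double/= addn0.
Qed.

Definition fiber_constant : set (linfty R) :=
  [set f | forall m n, fiber m = fiber n -> f m = f n].

(** A sequence is read at the indices [2 ^ j], which represent the fibres. *)
Definition null_along (s : nat -> nat) : set (linfty R) :=
  [set f | forall e : C, 0 < e ->
     exists N, forall n, (N <= n)%N -> `|f (2 ^ s n)%N| < e].

Lemma fiber_constant_subalgebra : subalgebra fiber_constant.
Proof.
split=> [//|f g rf rg|c f rf|f g rf rg] m n mn.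
- by rewrite !linftyD (rf _ _ mn) (rg _ _ mn).
- by rewrite !linftyZ (rf _ _ mn).
- by rewrite !linftyM (rf _ _ mn) (rg _ _ mn).
Qed.

Lemma eq_dist_small (x y : C) : (forall e : C, 0 < e -> `|x - y| < e) -> x = y.
Proof.
move=> xy; apply/eqP; rewrite -subr_eq0 -normr_eq0; apply: contrapT => /negP d0.
by have := xy `|x - y|; rewrite ltxx lt_neqAle eq_sym d0 normr_ge0 => /(_ isT).
Qed.

Lemma closure_eval f B m n : (forall g, B g -> g m = g n) ->
  closure B f -> f m = f n.
Proof.
move=> Bmn /closure_linftyP fB; apply: eq_dist_small => e e0.
have e20 : 0 < e / 2 by rewrite divr_gt0.
have [g Bg /linfty_norm_lt fg] := fB _ e20.
rewrite -(subrKA (g m)) (le_lt_trans (ler_normD _ _))// [ltRHS]splitr.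
by rewrite ltrD ?fg// (Bmn g Bg) distrC fg.
Qed.

Lemma fiber_constant_closed : closure fiber_constant `<=` fiber_constant.
Proof. by move=> f fB m n mn; apply: closure_eval fB => g; exact. Qed.

(** As the fibres are infinite, [f] takes each of its values arbitrarily far. *)
Lemma fiber_constant_c0 f : fiber_constant f -> c0 R f -> f = 0.
Proof.
move=> rf /cvgr0Pnorm_lt f0; apply: linfty_ext => m.
apply: eq_dist_small => e e0; rewrite subr0.
have [N _ fN] := f0 e e0.
have [n Nn nm] := fiber_infinite (fiber m) N.
by rewrite (rf _ _ (esym nm)) fN.
Qed.

Lemma null_along_subalgebra s : subalgebra (null_along s).
Proof.
split=> [e e0|f g f0 g0 e e0|c f f0 e e0|f g f0 g0 e e0].
- by exists 0%N => n _; rewrite normr0.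
- have e20 : 0 < e / 2 by rewrite divr_gt0.
  have [N fN] := f0 _ e20; have [M gM] := g0 _ e20.
  exists (maxn N M) => n; rewrite geq_max => /andP[Nn Mn].
  by rewrite linftyD (le_lt_trans (ler_normD _ _))// [ltRHS]splitr ltrD ?fN ?gM.
- have c1 : 0 < `|c| + 1 by rewrite ltr_wpDl.
  have [|N fN] := f0 (e / (`|c| + 1)); first exact: divr_gt0.
  exists N => n /fN; rewrite ltr_pdivlMr// linftyZ normrM mulrC.
  by apply: le_lt_trans; rewrite ler_wpM2r// lerDl.
- have g1 : 0 < `|g| + 1 by rewrite ltr_wpDl.
  have [|N fN] := f0 (e / (`|g| + 1)); first exact: divr_gt0.
  exists N => n /fN; rewrite ltr_pdivlMr// linftyM normrM.
  apply: le_lt_trans; rewrite ler_wpM2l//.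
  by rewrite (le_trans (le_linfty_norm _ _))// lerDl.
Qed.

Lemma null_along_closed s : closure (null_along s) `<=` null_along s.
Proof.
move=> f /closure_linftyP fB e e0.
have e20 : 0 < e / 2 by rewrite divr_gt0.
have [g g0 /linfty_norm_lt fg] := fB _ e20; have [N gN] := g0 _ e20.
exists N => n Nn; rewrite -(subrK (g (2 ^ s n)%N) (f _)).
by rewrite (le_lt_trans (ler_normD _ _))// [ltRHS]splitr ltrD ?fg ?gN.
Qed.

Lemma null_along_cst j f : null_along (fun=> j) f <-> f (2 ^ j)%N = 0.
Proof.
split=> [f0|f0 e e0]; last by exists 0%N => n _; rewrite f0 normr0.
by apply: eq_dist_small => e /f0[N fN]; rewrite subr0 (fN N).
Qed.

(** * The generators *)

Fact ind_subproof (E : set nat) :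
  (fun n => (`[< E (fiber n) >]%:R : C)) \in @bounded_seq R.
Proof.
by apply/bounded_seqP; exists 1 => n; case: asbool; rewrite ?normr1 ?normr0.
Qed.
Definition ind E : linfty R := Linfty (ind_subproof E).

Fact geo_subproof : (fun n => (2^-1 : C) ^+ fiber n) \in @bounded_seq R.
Proof.
apply/bounded_seqP; exists 1 => n.
by rewrite normrX exprn_ile1// normfV normr_nat invf_le1// ler1n.
Qed.
Definition geo : linfty R := Linfty geo_subproof.

Lemma indE E n : ind E n = `[< E (fiber n) >]%:R. Proof. by []. Qed.
Lemma geoE n : geo n = 2^-1 ^+ fiber n. Proof. by []. Qed.

Lemma ind_fiber_constant E : fiber_constant (ind E).
Proof. by move=> m n mn; rewrite !indE mn. Qed.

Lemma geo_fiber_constant : fiber_constant geo.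
Proof. by move=> m n mn; rewrite !geoE mn. Qed.

Lemma ind_star E : linfty_star (ind E) = ind E.
Proof. by apply: linfty_ext => n; exact: conjC_nat. Qed.

Lemma geo_star : linfty_star geo = geo.
Proof.
apply: linfty_ext => n; apply: conj_Creal.
by rewrite geoE ger0_real// exprn_ge0// invr_ge0.
Qed.

Lemma indM E F : ind E * ind F = ind (E `&` F).
Proof.
by apply: linfty_ext => n; rewrite linftyM !indE -natrM mulnb -asbool_and.
Qed.

(** * Generators separated by paths *)

Definition separated T (k : set T) (g : T -> linfty R) (s : T -> nat -> nat) :=
  (forall t u, k t -> k u -> t <> u -> null_along (s t) (g u)) /\
  (forall t, k t -> ~ null_along (s t) (g t)).

Lemma separated_card T (k : set T) (g : T -> linfty R) s :
  separated k g s -> g @` k #= k.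
Proof.
move=> [gne geq]; apply: inj_card_eq => t u /set_mem kt /set_mem ku gtu.
apply: contrapT => tu; apply: (geq t kt); rewrite gtu; exact: gne.
Qed.

Lemma separated_independent T (k : set T) (g : T -> linfty R) s :
  separated k g s -> linearly_independent (g @` k).
Proof.
move=> [gne geq].
apply: (separated_linearly_independent (W := fun t => null_along (s t))) => //.
by move=> t _; apply: subalgebra_subspace; exact: null_along_subalgebra.
Qed.

(** If [g t] is not in [S], the whole closed algebra generated by [S] is null
    along the path of [t]. *)
Lemma separated_minimal T (k : set T) (g : T -> linfty R) s S :
  separated k g s -> S `<` g @` k -> ~ (g @` k `<=` closure (alg_span S)).
Proof.
move=> [gne geq] [Sg nS] kS; apply: nS => _ [t kt <-]; apply: contrapT => St.
apply: (geq t kt); apply: null_along_closed.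
apply: closure_subset (kS _ (ex_intro2 _ _ t kt erefl)).
apply: alg_span_min (null_along_subalgebra _) _ => f Sf.
have [u ku fu] := Sg f Sf; rewrite -fu; apply: gne => // tu.
by apply: St; rewrite tu fu.
Qed.

Local Notation M := (([set: linfty R] `\` c0 R) `|` [set 0]).

Lemma fiber_constant_sub_M : fiber_constant `<=` M `|` [set 0].
Proof.
move=> f rf; have [f0|f0] := pselect (c0 R f); last by left; left.
by right; exact: fiber_constant_c0.
Qed.

Lemma algebrable_separated T U (k : set T) (a : set U) (g : T -> linfty R) s :
  separated k g s -> k !=set0 ->
  (forall t, k t -> fiber_constant (g t)) ->
  (forall t, k t -> linfty_star (g t) = g t) ->
  has_dim (alg_span (g @` k)) a -> algebrable M a k.
Proof.
move=> sep [t0 kt0] rg gstar dima; exists (alg_span (g @` k)); split=> //.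
- exact: alg_span_subalgebra.
- apply: subset_trans fiber_constant_sub_M.
  apply: alg_span_min; first exact: fiber_constant_subalgebra.
  by move=> _ [t kt <-]; exact: rg.
exists (g @` k); split; last exact: separated_card sep.
split; first split=> //.
- by exists (g t0), t0.
- exact: sub_alg_span.
- move=> _ f [t kt <-]; split; last by rewrite gstar.
  by apply: sub_alg_span; exists t.
move=> S Sg [_ _ _ SE]; apply: (separated_minimal sep Sg).
by rewrite SE => f gf; apply: subset_closure; exact: sub_alg_span.
Qed.

Lemma cstar_algebrable_separated T U (k : set T) (a : set U)
    (g : T -> linfty R) s :
  separated k g s -> k !=set0 ->
  (forall t, k t -> fiber_constant (g t)) ->
  (forall t, k t -> linfty_star (g t) = g t) ->
  has_dim (closure (alg_span (g @` k))) a -> cstar_algebrable M a k.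
Proof.
move=> sep [t0 kt0] rg gstar dima; exists (closure (alg_span (g @` k))).
have subg : g @` k `<=` closure (alg_span (g @` k)).
  by move=> f gf; apply: subset_closure; exact: sub_alg_span.
split=> //.
- split; [|apply: closure_star_closed|exact: closed_closure].
    by apply: closure_subalgebra; exact: alg_span_subalgebra.
  by apply: alg_span_star_closed => _ [t kt <-]; exact: gstar.
- apply: subset_trans fiber_constant_sub_M.
  apply: subset_trans fiber_constant_closed; apply: closure_subset.
  apply: alg_span_min; first exact: fiber_constant_subalgebra.
  by move=> _ [t kt <-]; exact: rg.
exists (g @` k); split; last exact: separated_card sep.
split; first split=> //.
- by exists (g t0), t0.
- by move=> f gf; split; [exact: subg|case: gf => t kt <-; rewrite gstar].
by move=> S Sg [_ _ SE]; apply: (separated_minimal sep Sg); rewrite SE.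
Qed.

(** The index [t0] is singled out so that [k] indices give exactly [k]
    generators, one of which is [geo], whatever the cardinal of [k]. *)
Definition tree_gen (T : Type) (t0 : T) (X : T -> set nat) (t : T) : linfty R :=
  if `[< t = t0 >] then geo else ind (range (branch (X t))).

Definition tree_path (T : Type) (t0 : T) (X : T -> set nat) (t : T) :
    nat -> nat :=
  if `[< t = t0 >] then fun=> 0%N else branch (X t).

Lemma geo_small (e : C) : 0 < e ->
  exists N, forall n, (N <= n)%N -> 2^-1 ^+ n < e.
Proof.
move=> e0.
have [N eN] : exists N : nat, e^-1 < N%:R.
  have V0 : 0 < e^-1 by rewrite invr_gt0.
  exists (Num.bound (complex.Re e^-1)).
  rewrite -[ltLHS]RRe_real ?gtr0_real// -(rmorph_nat (real_complex R)) ltcR.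
  apply: archi_boundP; rewrite -lecR RRe_real ?ltW// ger0_real// ltW//.
exists N => n Nn.
rewrite exprVn -[e]invrK ltf_pV2 ?posrE ?exprn_gt0 ?invr_gt0//.
rewrite (lt_le_trans eN)// -natrX ler_nat (leq_trans Nn)//.
by rewrite ltnW// ltn_expl.
Qed.

Lemma ind_branch_null X Y : X <> Y ->
  null_along (branch X) (ind (range (branch Y))).
Proof.
move=> /branch_disjoint[N XY] e e0; exists N => n /XY nY.
by rewrite indE fiber_pow asboolF// normr0.
Qed.

Lemma ind_branch_nnull X : ~ null_along (branch X) (ind (range (branch X))).
Proof.
move=> /(_ 1 ltr01)[N /(_ N (leqnn N))].
by rewrite indE fiber_pow asboolT ?normr1 ?ltxx//; exists N.
Qed.

(** [geo] decays along a branch because the nodes grow, and no branch contains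
    0, where [geo] is 1. *)
Lemma tree_separated T (k : set T) t0 (X : T -> set nat) :
  (forall t u, k t -> k u -> X t = X u -> t = u) ->
  separated k (tree_gen t0 X) (tree_path t0 X).
Proof.
move=> Xinj; rewrite /tree_gen /tree_path; split=> [t u kt ku tu|t kt].
- case: (asboolP (t = t0)) => [tt0|_].
    case: (asboolP (u = t0)) => [ut0|_]; first by rewrite tt0 ut0 in tu.
    apply/null_along_cst; rewrite indE fiber_pow asboolF// => -[n _ n0].
    by have := branch_gt (X u) n; rewrite n0.
  case: (asboolP (u = t0)) => [_|_]; last first.
    by apply: ind_branch_null => // XX; apply: tu; exact: Xinj.
  move=> e e0; have [N eN] := geo_small e0; exists N => n Nn.
  rewrite geoE fiber_pow ger0_norm ?exprn_ge0 ?invr_ge0//; apply: eN.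
  by rewrite (leq_trans Nn)// ltnW// branch_gt.
- case: (asboolP (t = t0)) => [_|_]; last exact: ind_branch_nnull.
  by move=> /null_along_cst; rewrite geoE fiber_pow expr0; exact/eqP/oner_neq0.
Qed.

(** * Continuum dimension *)

Lemma card_le_inj T U (A : set T) (B : set U) (phi : T -> U) :
  {in A &, injective phi} -> phi @` A `<=` B -> A #<= B.
Proof.
move=> /inj_card_eq /card_esym; rewrite card_eq_le => /andP[AB _] phiB.
exact: card_le_trans AB (subset_card_le phiB).
Qed.

Lemma ratr_cut (x y : R) :
  (forall q : rat, ratr q < x -> ratr q < y) -> x <= y.
Proof.
move=> xy; rewrite leNgt; apply/negP => yx.
have [q] := rat_in_itvoo yx; rewrite in_itv/= => /andP[yq /xy qy].
by have := lt_trans yq qy; rewrite ltxx.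
Qed.

(** A bounded sequence is determined by the rational cuts of the real and
    imaginary parts of its entries. *)
Lemma card_linfty : [set: linfty R] #<= [set: set nat].
Proof.
pose part (b : bool) (z : C) : R := if b then complex.Re z else complex.Im z.
pose code f : set nat :=
  [set pickle v | v in [set v : nat * bool * rat |
     ratr v.2 < part v.1.2 (f v.1.1)]].
apply: (@card_le_inj _ _ _ _ code) => // f g _ _ fg.
have le_part h h' n b : code h = code h' -> part b (h n) <= part b (h' n).
  move=> hh'; apply: ratr_cut => q hq.
  have : code h' (pickle (n, b, q)) by rewrite -hh'; exists (n, b, q).
  by move=> [v hv /(pcan_inj pickleK) ve]; rewrite ve in hv.
have eq_part n b : part b (f n) = part b (g n).
  by apply/eqP; rewrite eq_le !le_part.
apply: linfty_ext => n; move: (eq_part n true) (eq_part n false) => /=.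
by case: (f n) => [a b] /=; case: (g n) => [c d] /= -> ->.
Qed.

Lemma geo_head W N E : subspace W -> (forall i, (i < N)%N -> W (ind [set i])) ->
  W (geo * ind (E `&` `I_N)).
Proof.
move=> [W0 WD WZ]; elim: N => [_|N IH WN].
  rewrite (_ : geo * _ = 0)//; apply: linfty_ext => n.
  by rewrite linftyM indE asboolF ?mulr0// => -[].
have WE := IH (fun i iN => WN i (ltnW iN)); have WN1 := WN N (ltnSn N).
rewrite (_ : geo * _ = geo * ind (E `&` `I_N) +
                       (2^-1 ^+ N * `[< E N >]%:R : C) *: ind [set N]).
  by apply: WD => //; exact: WZ.
apply: linfty_ext => n.
rewrite linftyD linftyZ !linftyM !indE !geoE !asbool_and.
rewrite !asboolb ltnS leq_eqVlt; have [->|nN] := eqVneq (fiber n) N.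
  by rewrite ltnn andbT andbF mulr0 add0r (asboolT (erefl N)) mulr1.
by rewrite (@asboolF ([set N] (fiber n))) ?mulr0 ?addr0//; exact/eqP.
Qed.

(** Induction on [j]: removing from [geo] its values before [j], which involve
    only the previous atoms, and multiplying by [2 ^ j], gives a sequence equal
    to 1 at [j] and at most 1/2 elsewhere.  Its powers converge to the atom. *)
Lemma atom_mem W : subalgebra W -> closure W `<=` W -> W geo ->
  forall j, W (ind [set j]).
Proof.
move=> sW cW Wgeo; have [W0 WD WZ WM] := sW.
elim/ltn_ind => j IH; apply: cW; apply/closure_linftyP => e e0.
have [N eN] := geo_small e0.
pose u := (2 ^+ j : C) *: (geo - geo * ind (setT `&` `I_j)).
have Wu : W u.
  apply: WZ; apply: subalgebraB => //; apply: geo_head => //.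
  exact: subalgebra_subspace.
exists (u ^+ N.+1); first exact: subalgebraX.
have uE n : u n = if (fiber n < j)%N then 0 else 2^-1 ^+ (fiber n - j).
  rewrite linftyZ linftyB linftyM indE geoE setTI asboolb.
  case: ltnP => jn; first by rewrite mulr1 subrr mulr0.
  rewrite mulr0 subr0 -{1}(subnKC jn) exprD mulrA -exprMn mulfV ?pnatr_eq0//.
  by rewrite expr1n mul1r.
apply: le_lt_trans (eN N (leqnn N)).
apply: linfty_norm_le => n; rewrite linftyB linftyX uE indE.
have pN : 0 <= (2^-1 : C) ^+ N by rewrite exprn_ge0// invr_ge0.
have [fj|fj|fj] := ltngtP (fiber n) j.
- by rewrite asboolF ?expr0n/= ?subrr ?normr0// => fE; rewrite fE ltnn in fj.
- rewrite asboolF ?sub0r ?normrN => [|fE]; last by rewrite fE ltnn in fj.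
  rewrite -exprM ger0_norm ?exprn_ge0 ?invr_ge0//.
  apply: ler_wiXn2l; rewrite ?invr_ge0 ?invf_le1 ?ler1n//.
  by rewrite mulnC (leq_trans (leqnSn N))// leq_pmulr// subn_gt0.
- by rewrite asboolT// fj subnn expr0 expr1n subrr normr0.
Qed.

(** The truncations of the product are combinations of atoms, and the remainder
    after [N] terms is at most [2 ^- N]. *)
Lemma geo_ind_mem W : subalgebra W -> closure W `<=` W -> W geo ->
  forall E, W (geo * ind E).
Proof.
move=> sW cW Wgeo E; apply: (cW); apply/closure_linftyP => e e0.
have [N eN] := geo_small e0.
exists (geo * ind (E `&` `I_N)).
  apply: geo_head; first exact: subalgebra_subspace.
  by move=> i _; exact: (atom_mem sW cW Wgeo).
apply: le_lt_trans (eN N (leqnn N)); apply: linfty_norm_le => n.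
have pN : 0 <= (2^-1 : C) ^+ N by rewrite exprn_ge0// invr_ge0.
rewrite -mulrBr linftyM linftyB !indE geoE asbool_and asboolb.
have [nN|Nn] := ltnP (fiber n) N; first by rewrite andbT subrr mulr0 normr0.
rewrite andbF subr0 normrM -[leRHS]mulr1 ler_pM//.
  rewrite ger0_norm ?exprn_ge0 ?invr_ge0//.
  by apply: ler_wiXn2l; rewrite ?invr_ge0 ?invf_le1 ?ler1n.
by case: asbool; rewrite ?normr1 ?normr0.
Qed.

Definition null_beyond (s : nat -> nat) : set (linfty R) :=
  [set f | exists N, forall n, (N <= n)%N -> f (2 ^ s n)%N = 0].

Lemma null_beyond_subspace s : subspace (null_beyond s).
Proof.
split=> [|f h [N fN] [N' hN]|c f [N fN]]; first by exists 0%N.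
- exists (maxn N N') => n; rewrite geq_max => /andP[Nn Mn].
  by rewrite linftyD fN// hN// addr0.
- by exists N => n Nn; rewrite linftyZ fN// mulr0.
Qed.

Lemma half_gt0 : 0 < (2^-1 : C). Proof. by rewrite invr_gt0. Qed.

Lemma halfX_inj : injective (fun n => (2^-1 : C) ^+ n).
Proof.
by apply: ieexprIn half_gt0 _; rewrite invr_eq1 (eqr_nat C 2 1).
Qed.

Lemma geo_tree_nnull X :
  ~ null_beyond (branch X) (geo * ind (range (branch X))).
Proof.
move=> [N /(_ N (leqnn N))]/eqP; rewrite linftyM indE geoE fiber_pow asboolT.
  by rewrite mulr1 gt_eqF// exprn_gt0 ?half_gt0.
by exists N.
Qed.

Lemma geo_tree_null X Y : X <> Y ->
  null_beyond (branch X) (geo * ind (range (branch Y))).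
Proof.
move=> /branch_disjoint[N XY]; exists N => n /XY nY.
by rewrite linftyM indE fiber_pow asboolF// mulr0.
Qed.

Lemma linear_span_id W : subspace W -> linear_span W = W.
Proof.
move=> sW; apply/seteqP; split; last exact: sub_linear_span.
exact: linear_span_min.
Qed.

(** Since [geo] is null along every branch, the products of [geo] with branch
    indicators are separated by vanishing, not by tending to 0. *)
Lemma has_dim_continuum W : subalgebra W -> closure W `<=` W -> W geo ->
  has_dim W [set: set nat].
Proof.
move=> sW cW Wgeo; rewrite -(linear_span_id (subalgebra_subspace sW)).
pose h X := geo * ind (range (branch X)).
have hinj : injective h.
  move=> X Y XY; apply: contrapT => nXY.
  by apply: (@geo_tree_nnull X); rewrite -/(h X) XY; exact: geo_tree_null.
apply: (@has_dim_between _ _ _ _ (h @` setT)).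
- apply: (separated_linearly_independent
    (W := fun X => null_beyond (branch X))).
  + by move=> X _; exact: null_beyond_subspace.
  + by move=> X Y _ _; exact: geo_tree_null.
  + by move=> X _; exact: geo_tree_nnull.
- by move=> _ [X _ <-]; exact: geo_ind_mem.
- by apply: (@card_le_inj _ _ _ _ h) => // X Y _ _; exact: hinj.
- by move=> H _; apply: card_le_trans (card_leT _) card_linfty.
Qed.

(** * Countable dimension *)

(** A relation between the powers of [geo] is a polynomial with the infinitely
    many roots [2 ^- j]. *)
Lemma geo_powers_independent :
  linearly_independent ((fun j => geo ^+ j.+1) @` [set: nat]).
Proof.
move=> n c v vinj gv vc i.
have [k kE] : {k : 'I_n -> nat & forall i, geo ^+ (k i).+1 = v i}.
  apply: (@choice _ _ (fun i j => geo ^+ j.+1 = v i)) => j.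
  by have [m _] := gv j; exists m.
have kinj : injective k by move=> a b ab; apply: vinj; rewrite -!kE ab.
pose p : {poly C} := \sum_(i < n) c i *: 'X^((k i).+1).
have p0 : p = 0.
  apply: (@roots_geq_poly_eq0 _ p [seq 2^-1 ^+ j | j <- iota 0 (size p)]).
  - apply/allP => _ /mapP[j _ ->]; rewrite rootE horner_sum.
    have vj : \sum_(a < n) (c a *: v a : linfty R) (2 ^ j)%N = 0.
      by rewrite -linfty_sum vc.
    apply/eqP; rewrite -[RHS]vj; apply: eq_bigr => a _.
    by rewrite hornerZ hornerXn linftyZ -kE linftyX geoE fiber_pow.
  - by rewrite map_inj_uniq ?iota_uniq//; exact: halfX_inj.
  - by rewrite size_map size_iota.
have := congr1 (fun q : {poly C} => q`_(k i).+1) p0.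
rewrite coef0 coef_sum (bigD1 i)//= coefZ coefXn eqxx mulr1 big1 ?addr0//.
move=> j ji; rewrite coefZ coefXn eqSS eq_sym (inj_eq kinj).
by rewrite (negPf ji) mulr0.
Qed.

Lemma products_countable S : S #<= [set: nat] -> products S #<= [set: nat].
Proof.
move=> /pcard_injP[f finj].
pose w n := xget 0 [set x | S x /\ f x = n].
have wE x : S x -> w (f x) = x.
  move=> Sx; have [Sw fw] : [set y | S y /\ f y = f x] (w (f x)).
    by apply: xgetPex; exists x.
  by apply: finj; rewrite ?inE.
apply: card_le_trans (countableP [set: seq nat]).
apply: card_le_trans (card_image_le (fun l => \prod_(i <- l) w i) _).
apply: subset_card_le => _ [n [s [Ss ->]]].
exists [seq f (s i) | i <- index_enum 'I_n.+1] => //.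
by rewrite big_map; apply: eq_bigr => i _; exact: wE.
Qed.

Lemma has_dim_countable S : S #<= [set: nat] -> S geo ->
  has_dim (alg_span S) [set: nat].
Proof.
move=> S0 Sgeo; apply: has_dim_between geo_powers_independent _ _ _.
- move=> _ [j _ <-]; exists j, (fun=> geo); split=> //.
  by rewrite prodr_const card_ord.
- apply: (@card_le_inj _ _ _ _ (fun j => geo ^+ j.+1)) => // a b _ _ ab.
  have := congr1 (fun f : linfty R => f (2 ^ 1)%N) ab.
  by rewrite /= !linftyX !geoE fiber_pow => /halfX_inj[].
- move=> H /subset_card_le HS.
  exact: card_le_trans HS (products_countable S0).
Qed.

(** * Uncountable dimension *)

(** Hilbert's hotel: [k] contains a copy [u] of the natural numbers, the image
    of [A] is moved off the odd places of [u], and [B] is sent there. *)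
Lemma card_setU_countable T U (k : set T) (A B : set U) :
  [set: nat] #<= k -> A #<= k -> B #<= [set: nat] -> A `|` B #<= k.
Proof.
elim/Ppointed: T => T in k *.
  by rewrite card_le_emptyr => /eqP/seteqP[/(_ 0%N)] /(_ I).
move=> /pcard_leP/injfunPex[u uk uinj] /pcard_leP/injfunPex[a ak ainj].
move=> /pcard_injP[b binj].
have [shift [shiftu shiftN]] : exists shift : T -> T,
    (forall n, shift (u n) = u n.*2) /\
    (forall t, ~ range u t -> shift t = t).
  have [shift shiftP] : {shift : T -> T & forall t,
      (forall n, u n = t -> shift t = u n.*2) /\
      (~ range u t -> shift t = t)}.
    apply: (@choice _ _ (fun t y => (forall n, u n = t -> y = u n.*2) /\
      (~ range u t -> y = t))) => t.
    have [[n _ <-]|Nt] := pselect (range u t); last first.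
      by exists t; split=> // n unt; case: Nt; exists n.
    exists (u n.*2); split=> [m|]; last by case; exists n.
    by move=> /uinj -> //; rewrite inE.
  by exists shift; split=> [n|t]; [exact: (shiftP (u n)).1|exact: (shiftP t).2].
have uE m n : u m = u n -> m = n by move=> /uinj; apply; rewrite inE.
have shift_inj : injective shift.
  move=> x y; have [[n _ <-]|Nx] := pselect (range u x);
    have [[m _ <-]|Ny] := pselect (range u y); rewrite ?shiftu ?shiftN//.
  - by move=> /uE/double_inj ->.
  - by move=> uy; case: Ny; exists n.*2.
  - by move=> uy; case: Nx; exists m.*2.
have shift_odd x n : shift x <> u n.*2.+1.
  have [[m _ <-]|Nx] := pselect (range u x).
    by rewrite shiftu => /uE /(congr1 odd); rewrite /= !odd_double.
  by rewrite shiftN// => xE; case: Nx; exists n.*2.+1.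
pose phi x := if `[< A x >] then shift (a x) else u (b x).*2.+1.
apply: (@card_le_inj _ _ _ _ phi).
  move=> x y /set_mem ABx /set_mem ABy; rewrite /phi.
  case: asboolP => Ax; case: asboolP => Ay.
  - by move=> /shift_inj/ainj; apply; rewrite inE.
  - by move=> /shift_odd.
  - by move=> /esym/shift_odd.
  - move=> /uE/succn_inj/double_inj/binj; apply; rewrite inE.
      by case: ABx.
    by case: ABy.
move=> _ [x ABx <-]; rewrite /phi; case: asboolP => Ax; last exact: uk.
have [[n _ un]|Nx] := pselect (range u (a x)).
  by rewrite -un shiftu; exact: uk.
by rewrite shiftN//; exact: ak.
Qed.

Lemma branches_separated T (k : set T) (X : T -> set nat) :
  (forall t u, k t -> k u -> X t = X u -> t = u) ->
  separated k (fun t => ind (range (branch (X t)))) (fun t => branch (X t)).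
Proof.
move=> Xinj; split=> [t u kt ku tu|t kt]; last exact: ind_branch_nnull.
by apply: ind_branch_null => XX; apply: tu; exact: Xinj.
Qed.

(** Branches being almost disjoint, a product of generators is either one of
    them or the indicator of a finite set, and there are countably many finite
    sets. *)
Lemma has_dim_alg_span_branches T (k : set T) (X : T -> set nat) :
  [set: nat] #<= k ->
  (forall t u, k t -> k u -> X t = X u -> t = u) ->
  has_dim (alg_span ((fun t => ind (range (branch (X t)))) @` k)) k.
Proof.
move=> k0 Xinj.
have sep := branches_separated Xinj.
have /card_eqPle[gk kg] := separated_card sep.
apply: has_dim_between (separated_independent sep) (@sub_products _ _ _) kg _.
move=> H HG.
have GU : H `<=` ((fun t => ind (range (branch (X t)))) @` k) `|`
    (ind @` [set E | E `<=` [set: nat] /\ finite_set E]).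
  apply: subset_trans HG _ => _ [n [s [Ss ->]]].
  elim: n s Ss => [|n IH] s Ss; first by rewrite big_ord1; left.
  rewrite big_ord_recl; have [t kt <-] := Ss ord0.
  have [//|[u ku <-]|[E [_ finE] <-]] := IH (fun i => s (lift ord0 i)).
    have [->|tu] := pselect (t = u).
      by rewrite indM setIid; left; exists u.
    rewrite indM; right; eexists; last by []; split=> //.
    have [N XN] : exists N, forall n, (N <= n)%N ->
        ~ range (branch (X u)) (branch (X t) n).
      by apply: branch_disjoint => XX; apply: tu; exact: Xinj.
    apply: sub_finite_set (finite_image (branch (X t)) (finite_II N)).
    move=> _ [[m _ <-] mu]; exists m => //=; rewrite ltnNge; apply/negP => Nm.
    exact: XN mu.
  rewrite indM; right; eexists; last by []; split=> //.
  exact: finite_setIr.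
apply: card_le_trans (subset_card_le GU) _; apply: card_setU_countable => //.
apply: card_le_trans (card_image_le _ _) _.
exact: countable_finite_subset.
Qed.

(** * Finite dimension *)

Definition finitely_fibered d : set (linfty R) :=
  [set f | fiber_constant f /\ forall n, (d <= fiber n)%N -> f n = 0].

Lemma finitely_fibered_subalgebra d : subalgebra (finitely_fibered d).
Proof.
have [r0 rD rZ rM] := fiber_constant_subalgebra.
split=> [//|f g [rf f0] [rg g0]|c f [rf f0]|f g [rf f0] [rg g0]].
- by split=> [|n dn]; [exact: rD|rewrite linftyD f0// g0// addr0].
- by split=> [|n dn]; [exact: rZ|rewrite linftyZ f0// mulr0].
- by split=> [|n dn]; [exact: rM|rewrite linftyM f0// mul0r].
Qed.

Lemma finitely_fibered_closed d :
  closure (finitely_fibered d) `<=` finitely_fibered d.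
Proof.
move=> f fB; split.
  by apply: fiber_constant_closed; apply: closure_subset fB => g [].
move=> n dn; apply: eq_dist_small => e e0; rewrite subr0.
have /closure_linftyP/(_ e e0)[g [_ g0] /linfty_norm_lt/(_ n)] := fB.
by rewrite linftyB g0// subr0.
Qed.

Lemma atoms_separated (k : set nat) :
  separated k (fun j => ind [set j]) (fun j _ => j).
Proof.
split=> [t u _ _ tu|t _].
  by apply/null_along_cst; rewrite indE fiber_pow asboolF.
by move=> /null_along_cst/eqP; rewrite indE fiber_pow asboolT// oner_eq0.
Qed.

Lemma linear_span_atoms d :
  linear_span ((fun j => ind [set j]) @` `I_d) = finitely_fibered d.
Proof.
apply/seteqP; split.
  apply: linear_span_min.
    exact/subalgebra_subspace/finitely_fibered_subalgebra.
  move=> _ [j jd <-]; split; first exact: ind_fiber_constant.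
  by move=> n dn; rewrite indE asboolF// => nj; move: dn; rewrite nj leqNgt jd.
move=> f [rf f0].
exists d, (fun i => f (2 ^ i)%N), (fun i : 'I_d => ind [set (i : nat)]).
split=> [i|]; first by exists (i : nat) => //=.
apply: linfty_ext => n; rewrite linfty_sum.
transitivity (\sum_(i < d) f (2 ^ i)%N * ind [set (i : nat)] n); last by [].
have [nd|dn] := ltnP (fiber n) d; last first.
  rewrite f0// big1// => i _; rewrite indE asboolF ?mulr0// => ni.
  by move: dn; rewrite ni leqNgt ltn_ord.
rewrite (bigD1 (Ordinal nd))//= asboolT// mulr1 big1 ?addr0.
  by apply: rf; rewrite fiber_pow.
move=> i ni; rewrite asboolF ?mulr0// => nE.
by move/eqP: ni; apply; exact: val_inj.
Qed.

Lemma has_dim_finitely_fibered d : has_dim (finitely_fibered d) `I_d.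
Proof.
exists ((fun j => ind [set j]) @` `I_d); split; last first.
  exact: separated_card (atoms_separated _).
split; first exact: separated_independent (atoms_separated _).
exact: linear_span_atoms.
Qed.

Definition block m d : linfty R := geo * ind [set j | (m <= j < d)%N].

Lemma block_pow m d j :
  block m d (2 ^ j)%N = if (m <= j < d)%N then 2^-1 ^+ j else 0.
Proof.
rewrite linftyM indE geoE fiber_pow asboolb.
by case: ifP; rewrite ?mulr1 ?mulr0.
Qed.

(** Write [y] for [block m d], with value [y_i = 2 ^- i] at [i].  The product of
    the [y - y_i], over all the points [i <> j], vanishes outside [j] on the
    support of [y].  The factor [y] makes it vanish off this support
    too, and keeps the product in a subalgebra that need not contain 1. *)
Lemma block_atom W m d : subalgebra W -> W (block m d) ->
  forall j, (m <= j < d)%N -> W (ind [set j]).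
Proof.
move=> sW Wy j jm; have [_ _ WZ WM] := sW.
pose node i : C := 2^-1 ^+ i.
pose lagrange s : linfty R :=
  block m d * \prod_(i <- s) (block m d - node i *: 1).
have Wlag s : W (lagrange s).
  rewrite /lagrange; elim: s => [|i s IH]; first by rewrite big_nil mulr1.
  rewrite big_cons mulrCA mulrBl -scalerAl mul1r.
  by apply: subalgebraB => //; [exact: WM|exact: WZ].
have lagE s n :
    lagrange s n = block m d n * \prod_(i <- s) (block m d n - node i).
  rewrite linftyM; congr (_ * _); elim: s => [|i s IH].
    by rewrite !big_nil.
  by rewrite !big_cons linftyM IH linftyB linftyZ linfty1 mulr1.
pose s := [seq i <- iota 0 d | i != j].
pose c := lagrange s (2 ^ j)%N.
have c0 : c != 0.
  rewrite /c lagE block_pow jm; apply: mulf_neq0.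
    by rewrite expf_neq0// gt_eqF ?half_gt0.
  rewrite prodf_seq_neq0; apply/allP => i; rewrite mem_filter => /andP[ij _].
  by rewrite /= subr_eq0 (inj_eq halfX_inj) eq_sym.
rewrite (_ : ind [set j] = c^-1 *: lagrange s); first exact: WZ.
apply: linfty_ext => n.
have bn : block m d n = block m d (2 ^ fiber n)%N.
  by rewrite !linftyM !indE !geoE fiber_pow.
rewrite linftyZ indE; have [nj|nj] := eqVneq (fiber n) j.
  by rewrite asboolT// lagE bn nj -lagE mulVf.
rewrite asboolF ?lagE; last exact/eqP.
rewrite bn block_pow.
case: ifP => [/andP[mn nd]|_]; last by rewrite mul0r mulr0.
rewrite (big_rem (fiber n))/=; last by rewrite mem_filter nj mem_iota/= add0n.
by rewrite subrr mul0r !mulr0.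
Qed.

Definition block_gen m d t : linfty R :=
  if (t == m)%N then block m d else ind [set t].

Lemma block_gen_separated m d : (m < d)%N ->
  separated `I_m.+1 (block_gen m d) (fun j _ => j).
Proof.
move=> md; split=> [t u tm um tu|t tm].
  apply/null_along_cst; rewrite /block_gen; case: eqP => [um'|_].
    rewrite block_pow ifF//; apply/negbTE; rewrite negb_and -ltnNge.
    rewrite ltn_neqAle -ltnS tm andbT; apply/orP; left; apply/eqP => tm'.
    by apply: tu; rewrite tm'.
  by rewrite indE fiber_pow asboolF.
move=> /null_along_cst/eqP; rewrite /block_gen; case: (eqVneq t m) => [->|_].
  by rewrite block_pow leqnn md/= expf_eq0 gt_eqF ?half_gt0// andbF.
by rewrite indE fiber_pow asboolT// oner_eq0.
Qed.

Lemma block_gen_mem m d t : (m < d)%N -> (t < m.+1)%N ->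
  finitely_fibered d (block_gen m d t).
Proof.
move=> md tm; rewrite /block_gen; case: eqP => [_|_].
  split=> [|n dn]; last first.
    by rewrite linftyM indE asboolF ?mulr0//= ltnNge dn andbF.
  have [_ _ _ rM] := fiber_constant_subalgebra.
  by apply: rM; [exact: geo_fiber_constant|exact: ind_fiber_constant].
split=> [|n dn]; first exact: ind_fiber_constant.
rewrite indE asboolF// => nt; move: dn; rewrite nt leqNgt => /negP; apply.
by rewrite (leq_trans tm).
Qed.

Lemma alg_span_block_gen m d : (m < d)%N ->
  alg_span (block_gen m d @` `I_m.+1) = finitely_fibered d.
Proof.
move=> md; apply/seteqP; split.
  apply: alg_span_min; first exact: finitely_fibered_subalgebra.
  by move=> _ [t tm <-]; exact: block_gen_mem.
set S := _ @` _; have sS := alg_span_subalgebra S.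
rewrite -linear_span_atoms.
apply: linear_span_min; first exact: subalgebra_subspace.
move=> _ [j jd <-]; have [jm|mj] := ltnP j m.
  apply: sub_alg_span; exists j; first exact: ltnW.
  by rewrite /block_gen ltn_eqF.
apply: (block_atom (m := m) (d := d)) => //; last by rewrite mj.
apply: sub_alg_span; exists m => //=.
by rewrite /block_gen eqxx.
Qed.

Lemma algebrable_finite m d n : (m < d)%N -> (n < d)%N ->
  algebrable M `I_d `I_n.+1 /\ cstar_algebrable M `I_d `I_m.+1.
Proof.
have rec p t : (p < d)%N -> `I_p.+1 t -> fiber_constant (block_gen p d t).
  by move=> pd tp; have [] := block_gen_mem pd tp.
have self p t : linfty_star (block_gen p d t) = block_gen p d t.
  rewrite /block_gen; case: ifP => _; last exact: ind_star.
  by rewrite linfty_starM geo_star ind_star.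
move=> md nd; split.
  apply: (algebrable_separated (block_gen_separated nd)).
  - by exists 0%N.
  - by move=> t; exact: rec.
  - by move=> t _; exact: self.
  - by rewrite alg_span_block_gen//; exact: has_dim_finitely_fibered.
apply: (cstar_algebrable_separated (block_gen_separated md)).
- by exists 0%N.
- by move=> t; exact: rec.
- by move=> t _; exact: self.
rewrite alg_span_block_gen// (_ : closure _ = finitely_fibered d).
  exact: has_dim_finitely_fibered.
by apply/seteqP; split; [exact: finitely_fibered_closed|exact: subset_closure].
Qed.

(** * The four families of algebras *)

Lemma card_set_nat_inj T (k : set T) : k #<= [set: set nat] ->
  exists X : T -> set nat, forall t u, k t -> k u -> X t = X u -> t = u.
Proof.
by move=> /pcard_injP[X Xinj]; exists X => t u kt ku; apply: Xinj; rewrite inE.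
Qed.

Lemma tree_gen_fiber_constant T (t0 : T) X t : fiber_constant (tree_gen t0 X t).
Proof.
rewrite /tree_gen.
by case: asbool; [exact: geo_fiber_constant|exact: ind_fiber_constant].
Qed.

Lemma tree_gen_star T (t0 : T) X t :
  linfty_star (tree_gen t0 X t) = tree_gen t0 X t.
Proof.
by rewrite /tree_gen; case: asbool; [exact: geo_star|exact: ind_star].
Qed.

Lemma tree_gen_root T (t0 : T) X : tree_gen t0 X t0 = geo.
Proof. by rewrite /tree_gen asboolT. Qed.

Lemma cstar_algebrable_continuum T (k : set T) :
  k !=set0 -> k #<= [set: set nat] -> cstar_algebrable M [set: set nat] k.
Proof.
move=> [t0 kt0] /card_set_nat_inj[X Xinj].
apply: (cstar_algebrable_separated (tree_separated t0 Xinj)).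
- by exists t0.
- by move=> t _; exact: tree_gen_fiber_constant.
- by move=> t _; exact: tree_gen_star.
apply: has_dim_continuum.
- by apply: closure_subalgebra; exact: alg_span_subalgebra.
- by rewrite -((closure_id _).1 (@closed_closure _ _)).
apply: subset_closure; apply: sub_alg_span.
by exists t0; rewrite ?tree_gen_root.
Qed.

Lemma algebrable_countable T (k : set T) :
  k !=set0 -> k #<= [set: nat] -> algebrable M [set: nat] k.
Proof.
move=> [t0 kt0] k0; have /card_set_nat_inj[X Xinj] : k #<= [set: set nat].
  apply: card_le_trans k0 _; apply: (@card_le_inj _ _ _ _ set1) => // a b _ _.
  by move=> /seteqP[/(_ a erefl)].
apply: (algebrable_separated (tree_separated t0 Xinj)).
- by exists t0.
- by move=> t _; exact: tree_gen_fiber_constant.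
- by move=> t _; exact: tree_gen_star.
apply: has_dim_countable; last by exists t0; rewrite ?tree_gen_root.
exact: card_le_trans (card_image_le _ _) k0.
Qed.

Lemma algebrable_infinite T (k : set T) :
  [set: nat] #<= k -> k #<= [set: set nat] -> algebrable M k k.
Proof.
move=> k0 /card_set_nat_inj[X Xinj].
apply: (algebrable_separated (branches_separated Xinj)).
- by apply: infinite_setN0; apply/infiniteP.
- by move=> t _; exact: ind_fiber_constant.
- by move=> t _; exact: ind_star.
exact: has_dim_alg_span_branches.
Qed.

End Algebrability.

Theorem corollary3p24 (R : realType) :
  let M : set (linfty R) := ([set: linfty R] `\` c0 R) `|` [set 0] in
  (forall d m n : nat,
     (0 < d)%N -> (0 < m)%N -> (0 < n)%N -> (m <= d)%N -> (n <= d)%N ->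
     algebrable M `I_d `I_n /\ cstar_algebrable M `I_d `I_m) /\
  (forall (T : Type) (k : set T),
     `I_1 #<= k -> k #<= [set: set nat] ->
     cstar_algebrable M [set: set nat] k) /\
  (forall (T : Type) (k : set T),
     `I_1 #<= k -> k #<= [set: nat] ->
     algebrable M [set: nat] k) /\
  (forall (T : Type) (k : set T),
     card_lt [set: nat] k -> k #<= [set: set nat] ->
     algebrable M k k).
Proof.
have nonempty T (k : set T) : `I_1 #<= k -> k !=set0.
  move=> k1; apply/set0P/negP => /eqP k0; move: k1; rewrite k0 => /card_le0P.
  by move=> /seteqP[/(_ 0%N erefl)].
move=> M; split; [|split; [|split]].
- move=> d [//|m] [//|n] _ _ _ md nd; exact: algebrable_finite.
- by move=> T k /nonempty; exact: cstar_algebrable_continuum.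
- by move=> T k /nonempty; exact: algebrable_countable.
- by move=> T k [k0 _]; exact: algebrable_infinite.
Qed.
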